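(* Let $K\ge 2$ and let $g_1,\dots,g_K$ be given continuous corruption functions. Consider any algorithm that is uniformly efficient for the Bernoulli corrupt bandit problem with corruption functions $\{g_a\}_{a=1}^K$. Then for every Bernoulli corrupt bandit instance with mean rewards $\mu_1,\dots,\mu_K$ and mean feedbacks $\lambda_a=g_a(\mu_a)$ in which arm $1$ is the optimal arm ($\mu_1>\mu_a$ for all $a\ge 2$), writing $\Delta_a=\mu_1-\mu_a$, the algorithm satisfies $$\liminf_{T\rightarrow \infty}\frac{\mathrm{Regret}_T}{\log(T)} \;\geq\; \sum_{a = 2}^{K} \frac{\Delta_a}{d\left(\lambda_a,g_a(\mu_1)\right)}.$$
   Context: **Bernoulli corrupt bandit.** There are arms $A=\{1,\dots,K\}$ and known functions (corruption functions) $g_a$, $a\in A$, continuous on $[0,1]$ and mapping $[0,1]$ into $[0,1]$. An instance $\boldsymbol\nu$ is given by unknown mean rewards $\mu_1,\dots,\mu_K\in[0,1]$; the mean feedbacks are $\lambda_a=g_a(\mu_a)\in[0,1]$. At each time $t=1,2,\dots$ the learner selects an arm $\hat a_t$ based only on the previously observed feedbacks $F_1,\dots,F_{t-1}$ (and possibly internal randomization). If $\hat a_t=a$, a reward $R_t\sim\mathrm{Bernoulli}(\mu_a)$ is generated but not observed, and a feedback $F_t\sim\mathrm{Bernoulli}(\lambda_a)$ is observed; successive (reward, feedback) pairs from a given arm are i.i.d. and different arms are independent. **Regret.** $\mathrm{Regret}_T(\boldsymbol\nu)=\mathbb E_{\boldsymbol\nu}\big[T\max_a\mu_a-\sum_{t=1}^T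 R_t\big]=\sum_{a}(\max_b\mu_b-\mu_a)\,\mathbb E_{\boldsymbol\nu}[N_a(T)]$, where $N_a(T)$ is the number of times arm $a$ is selected up to time $T$. **Uniformly efficient.** An algorithm is uniformly efficient for the problem with prescribed corruption functions $\{g_a\}$ if for every instance $\boldsymbol\nu$ (every choice of mean rewards, with the same $g_a$'s), $\mathrm{Regret}_T(\boldsymbol\nu)=o(T^\alpha)$ as $T\to\infty$ for all $\alpha\in(0,1)$. **Divergence.** $d(x,y)=x\log(x/y)+(1-x)\log((1-x)/(1-y))$ is the Kullback–Leibler divergence between Bernoulli distributions of means $x$ and $y$, with the usual conventions ($0\log 0=0$, value $+\infty$ when absolute continuity fails). A term $\Delta_a/d$ with $\Delta_a>0$ is read as $+\infty$ if $d=0$ and as $0$ if $d=+\infty$.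
   Formalization: The formal theorem additionally assumes that the optimal mean satisfies μ_1 < 1; at μ_1 = 1 the claim fails, e.g. K=2, g_1(x)=x, g_2(x)=1/4+x/2, μ=(1,1/2), playing arm 1 until its first feedback 0 and then a UCB-type algorithm. *)

(* Defs.v *)
From HB Require Import structures.
From mathcomp Require Export all_boot all_order all_algebra.
From mathcomp Require Export all_classical all_reals all_analysis.
Set Implicit Arguments.
Unset Strict Implicit.
Unset Printing Implicit Defensive.
Import Order.TTheory GRing.Theory Num.Theory numFieldNormedType.Exports.
Local Open Scope classical_set_scope.
Local Open Scope ring_scope.

Record pmf (R : realType) (T : finType) := Pmf {
  pmf_fun :> T -> R ;
  pmf_ge0 : forall x, 0 <= pmf_fun x ;
  pmf_sum1 : \sum_x pmf_fun x = 1 }.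

Definition corruption_function (R : realType) (g : R -> R) : Prop :=
  {within `[0, 1], continuous g} /\
  (forall x, x \in `[0, 1]%R -> g x \in `[0, 1]%R).

(* [law a] is the joint law of a (reward, feedback) pair of arm [a]. Only its
   two marginals are prescribed, the coupling between them being arbitrary. *)
Record bandit (R : realType) (K : nat) (g : 'I_K -> R -> R) := Bandit {
  mean : 'I_K -> R ;
  mean01 : forall a, mean a \in `[0, 1]%R ;
  law : 'I_K -> pmf R (bool * bool)%type ;
  reward_law : forall a r, \sum_f law a (r, f) = bernoulli_pmf (mean a) r ;
  feedback_law :
    forall a f, \sum_r law a (r, f) = bernoulli_pmf (g a (mean a)) f }.

Definition feedback_mean (R : realType) (K : nat) (g : 'I_K -> R -> R)
  (nu : bandit g) (a : 'I_K) : R := g a (mean nu a).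

(* Law of the next arm given the past (arm, feedback) pairs, listed in
   chronological order. With internal randomization, the arms selected so far
   are not determined by the feedbacks, hence their presence in the past; the
   unobserved rewards are absent from it. *)
Definition algorithm (R : realType) (K : nat) : Type :=
  seq ('I_K * bool) -> pmf R 'I_K.

(* One round is (selected arm, (reward, feedback)). *)
Definition trajectory (K T : nat) : finType :=
  T.-tuple ('I_K * (bool * bool))%type.

Definition observed (K : nat) (s : seq ('I_K * (bool * bool))) :
  seq ('I_K * bool) := [seq (x.1, x.2.2) | x <- s].

(* Law of the first [T] rounds. The fresh pair revealed at round [t] is drawn
   from the law of the selected arm independently of the past, which is the
   i.i.d. assumption within arms and the independence across arms. *)
Definition trajectory_prob (R : realType) (K : nat) (g : 'I_K -> R -> R)
    (nu : bandit g) (pi : algorithm R K) (T : nat) (w : trajectory K T) : R :=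
  \prod_(t < T) (pi (observed (take t w)) (tnth w t).1 *
                 law nu (tnth w t).1 (tnth w t).2).

Definition expectation_traj (R : realType) (K : nat) (g : 'I_K -> R -> R)
    (nu : bandit g) (pi : algorithm R K) (T : nat)
    (X : trajectory K T -> R) : R :=
  \sum_(w : trajectory K T) trajectory_prob nu pi w * X w.

(* Means being nonnegative, 0 is a neutral default value for the maximum. *)
Definition best_mean (R : realType) (K : nat) (g : 'I_K -> R -> R)
  (nu : bandit g) : R := \big[Num.max/0]_(a < K) mean nu a.

Definition regret (R : realType) (K : nat) (g : 'I_K -> R -> R)
    (pi : algorithm R K) (nu : bandit g) (T : nat) : R :=
  expectation_traj nu pi (fun w : trajectory K T =>
    T%:R * best_mean nu - \sum_(t < T) ((tnth w t).2.1 : nat)%:R).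

Definition uniformly_efficient (R : realType) (K : nat) (g : 'I_K -> R -> R)
    (pi : algorithm R K) : Prop :=
  forall (nu : bandit g) (alpha : R), 0 < alpha < 1 ->
    (regret pi nu : nat -> R^o) =o_\oo (fun T : nat => T%:R `^ alpha : R^o).

Definition kl_term (R : realType) (x y : R) : \bar R :=
  if x == 0 then 0%E else if y == 0 then +oo%E else (x * ln (x / y))%:E.

(* Kullback-Leibler divergence between Bernoulli laws of means x, y in [0, 1].
   Both summands are > -oo, so no indeterminate sum arises. *)
Definition bernoulli_kl (R : realType) (x y : R) : \bar R :=
  (kl_term x y + kl_term (1 - x) (1 - y))%E.

Definition first_arm (K : nat) (hK : (2 <= K)%N) : 'I_K :=
  Ordinal (ltnW hK).

(* Main.v *)
(* Lai and Robbins' change of measure. For an arm a, let nu' be the instance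
   obtained from nu by raising the mean of arm a to some m' > mu_1, close enough
   to mu_1 for d' = d(lambda_a, g_a(m')) to be close to d(lambda_a, g_a(mu_1)).
   Only the feedbacks of arm a have a different law under nu', so the divergence
   between the laws of the observations is E_nu[N_a(T)] d'. As a is the only
   optimal arm of nu', efficiency gives T - E_nu'[N_a(T)] = o(T^alpha), and the
   Donsker-Varadhan inequality for (1 - alpha) log T (1 - N_a(T)/T) yields
     (1 - alpha) log T (1 - E_nu[N_a(T)]/T) <= d' E_nu[N_a(T)] + log 2.
   Efficiency is not needed at nu itself: E_nu[N_a(T)] < c log T already makes
   E_nu[N_a(T)]/T negligible. *)
Require Import Defs.
From mathcomp Require Import ring lra.
Import Order.TTheory GRing.Theory Num.Theory numFieldNormedType.Exports.
Local Open Scope classical_set_scope.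
Local Open Scope ring_scope.

(** * Divergence between Bernoulli laws and its variational inequality *)

Section Divergence.
Set Implicit Arguments.
Unset Strict Implicit.
Unset Printing Implicit Defensive.
Variable R : realType.
Implicit Types x y A B S : R.

(** As [z / 0 = 0] and [ln 0 = 0], this real number is the divergence only under
    [bernoulli_abs_cont], the case where the divergence is finite. *)
Definition bernoulli_klr x y : R := x * ln (x / y) + (1 - x) * ln ((1 - x) / (1 - y)).

Definition bernoulli_abs_cont x y : bool :=
  ((x == 0) || (y != 0)) && ((1 - x == 0) || (1 - y != 0)).

Lemma bernoulli_klE x y : bernoulli_abs_cont x y ->
  bernoulli_kl x y = (bernoulli_klr x y)%:E.
Proof.
have termE u v : (u == 0) || (v != 0) -> kl_term u v = (u * ln (u / v))%:E.
  rewrite /kl_term; case: eqVneq => [->|_] /=; first by rewrite mul0r.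
  by move/negbTE ->.
by case/andP=> h1 h2; rewrite /bernoulli_kl !termE.
Qed.

Lemma kl_term_neqNy x y : kl_term x y != -oo%E.
Proof. by rewrite /kl_term; case: ifP => // _; case: ifP. Qed.

Lemma bernoulli_kl_infty x y : ~~ bernoulli_abs_cont x y ->
  bernoulli_kl x y = +oo%E.
Proof.
have termE u v : ~~ ((u == 0) || (v != 0)) -> kl_term u v = +oo%E.
  by rewrite negb_or negbK /kl_term => /andP[/negbTE -> ->].
rewrite negb_and /bernoulli_kl => /orP[] /termE ->.
  by rewrite addye// kl_term_neqNy.
by rewrite addey// kl_term_neqNy.
Qed.

(* [ln z <= z - 1] at [z = y A / (x S)]. *)
Lemma mul_ln_le x y A S : 0 <= x -> 0 <= y -> (x == 0) || (y != 0) ->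
  0 < A -> 0 < S ->
  x * ln A - x * ln (x / y) <= x * ln S + (y * A / S - x).
Proof.
move=> x0 y0 xy A0 S0; have [->|xN0] := eqVneq x 0.
  by rewrite !(mul0r, subr0, oppr0, add0r, addr0) mulr_ge0 ?invr_ge0 ?mulr_ge0 // ltW.
move: xy; rewrite (negbTE xN0) /= => yN0.
have {}x0 : 0 < x by rewrite lt_neqAle eq_sym xN0.
have {}y0 : 0 < y by rewrite lt_neqAle eq_sym yN0.
pose z := (y * A) / (x * S).
have z0 : 0 < z by rewrite divr_gt0 ?mulr_gt0.
have lnz : ln z = ln A - ln (x / y) - ln S.
  rewrite /z !ln_div ?lnM ?posrE ?mulr_gt0 //; ring.
have : ln z <= z - 1.
  by rewrite -[X in ln X](subrKC 1) le_ln1Dx // ltrBDr addrC subrr.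
rewrite lnz => /(ler_wpM2l (ltW x0)).
have -> : x * (z - 1) = y * A / S - x.
  by rewrite /z; field; rewrite !gt_eqF.
by rewrite !mulrBr; lra.
Qed.

Lemma bernoulli_sum_gt0 y A B : y \in `[0, 1]%R -> 0 < A -> 0 < B ->
  0 < y * A + (1 - y) * B.
Proof.
rewrite in_itv /= => /andP[y0 y1] A0 B0.
have [hy|hy] := ltP (1/2) y.
  by rewrite ltr_pwDl ?mulr_gt0 ?mulr_ge0 ?(ltW B0) //; lra.
by rewrite ltr_wpDl ?mulr_gt0 ?mulr_ge0 ?(ltW A0) //; lra.
Qed.

(** Donsker-Varadhan inequality on two points, [A] and [B] being the exponentials of the test
    function. It adds up [mul_ln_le] over both outcomes, with [S] the mean of [A] and [B] under [y];
    the correction terms then cancel. *)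
Lemma bernoulli_gibbs x y A B : x \in `[0, 1]%R -> y \in `[0, 1]%R ->
  bernoulli_abs_cont x y -> 0 < A -> 0 < B ->
  x * ln A + (1 - x) * ln B - bernoulli_klr x y
  <= ln (y * A + (1 - y) * B).
Proof.
rewrite !in_itv /= => /andP[x0 x1] /andP[y0 y1] /andP[h0 h1] A0 B0.
set S := y * A + _.
have S0 : 0 < S by apply: bernoulli_sum_gt0 => //; rewrite in_itv /= y0 y1.
have e0 := mul_ln_le x0 y0 h0 A0 S0.
have x1' : 0 <= 1 - x by lra.
have y1' : 0 <= 1 - y by lra.
have e1 := mul_ln_le x1' y1' h1 B0 S0.
have SE : y * A / S + (1 - y) * B / S = 1.
  by rewrite -mulrDl divff // gt_eqF.
rewrite /bernoulli_klr; lra.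
Qed.

Lemma bernoulli_pmf_itv_ge0 (p : R) f : p \in `[0, 1]%R -> 0 <= bernoulli_pmf p f.
Proof. by rewrite in_itv => p01; exact: bernoulli_pmf_ge0. Qed.

Lemma sum_bernoulli_pmf (p : R) : \sum_f bernoulli_pmf p f = 1.
Proof. by rewrite big_bool /= /bernoulli_pmf subrKC. Qed.

Lemma pmf_sum_gt0 (I : finType) (p : pmf R I) (G : I -> R) :
  (forall i, 0 < G i) -> 0 < \sum_i p i * G i.
Proof.
move=> G0; have h i : true -> 0 <= p i * G i.
  by move=> _; rewrite mulr_ge0 ?pmf_ge0 // ltW.
rewrite lt_neqAle sumr_ge0 // andbT eq_sym; apply/negP => /eqP/(psumr_eq0P h) pG.
have := pmf_sum1 p; rewrite big1 => [/eqP|i _]; first by rewrite eq_sym oner_eq0.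
by apply/eqP; have /eqP := pG i isT; rewrite mulf_eq0 (gt_eqF (G0 i)) orbF.
Qed.

(** Jensen's inequality, again from [mul_ln_le], now with both weights equal to [p i] and [S] the
    mean of [G]. *)
Lemma pmf_jensen_ln (I : finType) (p : pmf R I) (G : I -> R) :
  (forall i, 0 < G i) -> \sum_i p i * ln (G i) <= ln (\sum_i p i * G i).
Proof.
move=> G0; set S := \sum_i p i * G i.
have S0 : 0 < S by exact: pmf_sum_gt0.
apply: (@le_trans _ _ (\sum_i (p i * ln S + (p i * G i / S - p i)))).
  apply: ler_sum => i _.
  have [p0|pN0] := eqVneq (p i) 0; first by rewrite p0 !mul0r subrr addr0.
  apply: le_trans (mul_ln_le (pmf_ge0 p i) (pmf_ge0 p i) _ (G0 i) S0).
    by rewrite divff // ln1 mulr0 subr0.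
  by rewrite pN0 orbT.
rewrite big_split /= sumrB -mulr_suml -mulr_suml pmf_sum1 -/S divff ?gt_eqF //.
by rewrite subrr addr0 mul1r.
Qed.

Lemma bernoulli_klrxx y : bernoulli_klr y y = 0.
Proof.
rewrite /bernoulli_klr.
have h (z : R) : z * ln (z / z) = 0.
  by have [->|zN0] := eqVneq z 0; rewrite ?mul0r // divff // ln1 mulr0.
by rewrite !h addr0.
Qed.

(** Convexity of the exponential between [0] and [L]: it is [bernoulli_gibbs] for two equal laws,
    with [A = expR L] and [B = 1]. *)
Lemma expR_chord y (L : R) : y \in `[0, 1]%R ->
  expR (L * y) <= 1 + y * (expR L - 1).
Proof.
move=> y01.
have ac : bernoulli_abs_cont y y.
  by rewrite /bernoulli_abs_cont !orbN.
have := bernoulli_gibbs y01 y01 ac (expR_gt0 L) ltr01.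
rewrite bernoulli_klrxx.
rewrite ln1 mulr0 addr0 subr0 expRK => h.
have S0 := bernoulli_sum_gt0 y01 (expR_gt0 L) ltr01.
rewrite mulrC -[leRHS]lnK ?ler_expR; last by rewrite posrE; lra.
by apply: le_trans h _; rewrite le_eqVlt; apply/orP; left; apply/eqP; congr ln; ring.
Qed.

Lemma bernoulli_klr_ge0 (x y : R) : x \in `[0, 1]%R -> y \in `[0, 1]%R ->
  bernoulli_abs_cont x y -> 0 <= bernoulli_klr x y.
Proof.
move=> x01 y01 ac; have := bernoulli_gibbs x01 y01 ac ltr01 ltr01.
by rewrite !ln1 !mulr1 !mulr0 subrKC ln1; lra.
Qed.

Lemma bernoulli_kl_ge0 (x y : R) : x \in `[0, 1]%R -> y \in `[0, 1]%R ->
  (0 <= bernoulli_kl x y)%E.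
Proof.
move=> x01 y01; have [ac|/bernoulli_kl_infty -> //] := boolP (bernoulli_abs_cont x y).
by rewrite bernoulli_klE // lee_fin bernoulli_klr_ge0.
Qed.

(** Both conditions on [h m] are open and [h] is right-continuous at [m], so they persist slightly
    to the right of [m]. Writing [c * d < 1] instead of [c < 1 / d] includes a zero divergence. *)
Lemma alternative_mean (h : R -> R) (l m c : R) :
  corruption_function h -> l \in `[0, 1]%R -> 0 <= m < 1 ->
  bernoulli_abs_cont l (h m) -> c * bernoulli_klr l (h m) < 1 ->
  exists m', [/\ m < m' <= 1, bernoulli_abs_cont l (h m') &
                 c * bernoulli_klr l (h m') < 1].
Proof.
move=> [hc h01] l01 /andP[m0 m1] ac cd.
have hm : h x @[x --> m^'+] --> h m.
  have /(continuous_within_itvP _ m1)[] // : {within `[m, 1], continuous h}.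
  apply: continuous_subspaceW hc => x /=; rewrite !in_itv /=.
  by move=> /andP[mx ->]; rewrite andbT (le_trans m0).
have stay (u v : R) (k : R -> R) : (u == 0) || (v != 0) -> 0 <= v ->
    k x @[x --> m^'+] --> v ->
    \forall x \near m^'+, (u == 0) || (k x != 0).
  move=> /orP[-> //|vN0] v0 kv; first by near=> x.
  near=> x; apply/orP; right; rewrite gt_eqF //; near: x.
  by apply: (cvgr_gt v) => //; rewrite lt_neqAle eq_sym vN0.
(* [ln] is discontinuous at 0, but [v = 0] is allowed only with [u = 0], where the term is
   constantly 0. *)
have termc (u v : R) (k : R -> R) : (u == 0) || (v != 0) -> 0 <= u -> 0 <= v ->
    k x @[x --> m^'+] --> v ->
    (u * ln (u / k x)) @[x --> m^'+] --> u * ln (u / v).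
  have [->|uN0] /= := eqVneq u 0.
    move=> _ _ _ _; under eq_cvg do rewrite mul0r.
    by rewrite mul0r; exact: cvg_cst.
  move=> vN0 u0 v0 kv; apply: cvgMl_tmp => //.
  apply: (@continuous_cvg _ _ _ _ _ _ (@ln R)).
    by apply: continuous_ln; rewrite divr_gt0 // lt_neqAle eq_sym ?uN0 ?vN0.
  by apply: cvgMl_tmp; apply: cvgV.
have y01 := h01 m _; rewrite in_itv /= m0 (ltW m1) /= in y01.
have {y01} := y01 isT; rewrite in_itv /= => /andP[y0 y1].
move: l01; rewrite in_itv /= => /andP[l0 l1].
have hm1 : (1 - h x) @[x --> m^'+] --> 1 - h m by apply: cvgB => //; exact: cvg_cst.
have klc : (c * bernoulli_klr l (h x)) @[x --> m^'+] --> c * bernoulli_klr l (h m).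
  apply: cvgMl_tmp => //; case/andP: ac => ac0 ac1.
  by apply: cvgD; apply: termc => //; rewrite subr_ge0.
case/andP: ac => ac0 ac1.
have : \forall x \near m^'+, [/\ m < x <= 1, bernoulli_abs_cont l (h x) &
                 c * bernoulli_klr l (h x) < 1].
  near=> x; split.
  - apply/andP; split; near: x; first exact: nbhs_right_gt.
    exact: nbhs_right_le.
  - apply/andP; split; near: x; first exact: stay ac0 _ hm.
    by apply: stay ac1 _ hm1; rewrite subr_ge0.
  - by near: x; exact: (cvgr_lt _ klc).
by move/filter_ex.
Unshelve. all: by end_near. Qed.

(** From [ln x = 2 ln (sqrt x)] and [ln z < z]. This keeps [ln T * N / T] bounded as soon as
    [N < c ln T]. *)
Lemma sqr_ln_le (x : R) : 1 <= x -> ln x ^+ 2 <= 4 * x.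
Proof.
move=> x1; have s0 : 0 < Num.sqrt x by rewrite sqrtr_gt0; lra.
have x0 : 0 <= x by lra.
have lx : 0 <= ln x by exact: ln_ge0.
have xs : ln x = ln (Num.sqrt x) *+ 2 by rewrite -lnXn // sqr_sqrtr.
have := ln_sublinear s0; rewrite mulr2n in xs => h.
have e := sqr_sqrtr x0; rewrite expr2 in e *; nra.
Qed.

End Divergence.

(** * Expectations over trajectories and change of measure *)

Section Trajectories.
Set Implicit Arguments.
Unset Strict Implicit.
Unset Printing Implicit Defensive.
Variables (R : realType) (K : nat) (g : 'I_K -> R -> R).
Implicit Types (nu : bandit g) (pi : algorithm R K) (a b : 'I_K).

Definition step := ('I_K * (bool * bool))%type.

(** [X] takes lists of any length, so that inductions on [T] can peel off a round without casts
    between tuple types. *)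
Definition expect nu pi T (X : seq step -> R) : R :=
  expectation_traj nu pi (fun w : trajectory K T => X w).

(** The continuation of the algorithm after the first observation [o]. *)
Definition shift pi (o : 'I_K * bool) : algorithm R K := fun s => pi (o :: s).

Lemma sum_pair (I J : finType) (F : I * J -> R) :
  \sum_x F x = \sum_i \sum_j F (i, j).
Proof. by rewrite pair_bigA; apply: eq_bigr; case. Qed.

(** Conditioning on the first round: the remaining rounds form a trajectory of the shifted
    algorithm. The reward is summed innermost because the continuation does not depend on it. *)
Lemma expectS nu pi T X : expect nu pi T.+1 X =
  \sum_a pi [::] a * \sum_f \sum_r law nu a (r, f) *
    expect nu (shift pi (a, f)) T (fun s => X ((a, (r, f)) :: s)).
Proof.
rewrite /expect /expectation_traj.
rewrite (reindex (fun x : step * trajectory K T => [tuple of x.1 :: x.2])) /=;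
  last first.
  exists (fun w : trajectory K T.+1 => (thead w, [tuple of behead w])).
    by case=> x w _; congr pair; apply/val_inj.
  by move=> w _; rewrite -tuple_eta.
rewrite !sum_pair /=; apply: eq_bigr => a _.
rewrite sum_pair exchange_big /= mulr_sumr; apply: eq_bigr => f _.
rewrite mulr_sumr; apply: eq_bigr => r _.
rewrite mulrA mulr_sumr; apply: eq_bigr => w _.
rewrite mulrA; congr (_ * _).
rewrite /trajectory_prob big_ord_recl /=; congr (_ * _).
by apply: eq_bigr => t _; rewrite tnthS.
Qed.

Lemma expect0 nu pi X : expect nu pi 0 X = X [::].
Proof.
rewrite /expect /expectation_traj (big_pred1 [tuple]) => [|w]; last first.
  by apply/esym/eqP; rewrite (tuple0 w).
by rewrite /trajectory_prob big_ord0 mul1r.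
Qed.

Lemma expect_eq nu pi T (X Y : seq step -> R) :
  (forall s, size s = T -> X s = Y s) -> expect nu pi T X = expect nu pi T Y.
Proof. by move=> XY; apply: eq_bigr => w _; rewrite XY ?size_tuple. Qed.

Lemma expectD nu pi T X Y :
  expect nu pi T (fun s => X s + Y s) = expect nu pi T X + expect nu pi T Y.
Proof. by rewrite -big_split; apply: eq_bigr => w _; rewrite mulrDr. Qed.

Lemma expectZ nu pi T (c : R) X :
  expect nu pi T (fun s => c * X s) = c * expect nu pi T X.
Proof. by rewrite [RHS]mulr_sumr; apply: eq_bigr => w _; rewrite mulrCA. Qed.

Lemma expect_sum nu pi T (I : finType) (P : pred I) (X : I -> seq step -> R) :
  expect nu pi T (fun s => \sum_(i | P i) X i s) = \sum_(i | P i) expect nu pi T (X i).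
Proof. by rewrite exchange_big; apply: eq_bigr => w _; rewrite mulr_sumr. Qed.

Lemma sum_law nu a (h : bool -> R) :
  \sum_f \sum_r law nu a (r, f) * h f =
  feedback_mean nu a * h true + (1 - feedback_mean nu a) * h false.
Proof.
rewrite big_bool /= -!mulr_suml !feedback_law.
by rewrite /bernoulli_pmf /feedback_mean.
Qed.

Lemma expect1 nu pi T : expect nu pi T (fun=> 1) = 1.
Proof.
elim: T pi => [|T IH] pi; first by rewrite expect0.
rewrite expectS -[RHS](pmf_sum1 (pi [::])); apply: eq_bigr => a _.
under eq_bigr do under eq_bigr do rewrite IH.
by rewrite sum_law !mulr1 subrKC mulr1.
Qed.

Lemma expect_cst nu pi T (c : R) : expect nu pi T (fun=> c) = c.
Proof.
rewrite -[RHS]mulr1 -(expect1 nu pi T) -expectZ.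
by apply: expect_eq => s _; rewrite mulr1.
Qed.

Lemma ler_expect nu pi T X Y : (forall s, size s = T -> X s <= Y s) ->
  expect nu pi T X <= expect nu pi T Y.
Proof.
move=> XY; apply: ler_sum => w _; apply: ler_wpM2l; last first.
  by apply: XY; rewrite size_tuple.
by apply: prodr_ge0 => t _; rewrite mulr_ge0 ?pmf_ge0.
Qed.

(* The rewards being unobserved, they integrate out one round at a time. *)
Lemma expect_observedS nu pi T (F : seq ('I_K * bool) -> R) :
  let G a f := expect nu (shift pi (a, f)) T (fun s => F ((a, f) :: observed s)) in
  expect nu pi T.+1 (F \o @observed K) =
  \sum_a pi [::] a * (feedback_mean nu a * G a true +
                      (1 - feedback_mean nu a) * G a false).
Proof.
move=> G; rewrite expectS; apply: eq_bigr => a _; congr (_ * _).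
by rewrite -sum_law.
Qed.

(** The feedback mean and its complement are marginal masses of [law nu a], hence nonnegative. *)
Lemma feedback_mean01 nu a : feedback_mean nu a \in `[0, 1]%R.
Proof.
rewrite in_itv /= -subr_ge0 -[X in _ && X]subr_ge0 subr0.
have := feedback_law nu a true; have := feedback_law nu a false.
rewrite /= /feedback_mean => <- <-.
by rewrite !sumr_ge0 // => r _; exact: pmf_ge0.
Qed.

Lemma expect_gt0 nu pi T (F : seq ('I_K * bool) -> R) :
  (forall o, 0 < F o) -> 0 < expect nu pi T (F \o @observed K).
Proof.
elim: T pi F => [|T IH] pi F F0; first by rewrite expect0 /=.
rewrite expect_observedS; apply: pmf_sum_gt0 => a.
by apply: bernoulli_sum_gt0; rewrite ?feedback_mean01 //;
   apply: (IH _ (fun o => F (_ :: o))) => o.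
Qed.

Definition pulls a (o : seq ('I_K * bool)) : nat := count (fun x => x.1 == a) o.

Definition expected_pulls nu pi T a : R :=
  expect nu pi T (fun s => (pulls a (observed s))%:R).

(* The data-processing inequality and the chain rule for the divergence at once,
   in their Donsker-Varadhan form. *)
Lemma change_of_measure nu nu' a pi T (F : seq ('I_K * bool) -> R) :
  (forall b, b != a -> feedback_mean nu' b = feedback_mean nu b) ->
  bernoulli_abs_cont (feedback_mean nu a) (feedback_mean nu' a) ->
  expect nu pi T (F \o @observed K) -
    bernoulli_klr (feedback_mean nu a) (feedback_mean nu' a) *
      expected_pulls nu pi T a
  <= ln (expect nu' pi T (fun s => expR (F (observed s)))).
Proof.
move=> nub nua; set d := bernoulli_klr _ _.
elim: T pi F => [|T IH] pi F.
  by rewrite /expected_pulls !expect0 /= mulr0 subr0 expRK.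
pose G b f := expect nu' (shift pi (b, f)) T
  (fun s => expR (F ((b, f) :: observed s))).
have G0 b f : 0 < G b f.
  by apply: (@expect_gt0 _ _ _ (fun o => expR (F (_ :: o)))) => o; exact: expR_gt0.
rewrite (expect_observedS nu' _ _ (expR \o F)) -/G.
pose H b := feedback_mean nu' b * G b true + (1 - feedback_mean nu' b) * G b false.
have H0 b : 0 < H b by apply: bernoulli_sum_gt0; rewrite ?feedback_mean01.
(* The first arm has the same law under both instances, so its draw costs no divergence and Jensen's
   inequality suffices. *)
apply: le_trans (pmf_jensen_ln (pi [::]) H0).
have -> : expected_pulls nu pi T.+1 a = \sum_b pi [::] b *
   ((b == a)%:R + (feedback_mean nu b * expected_pulls nu (shift pi (b, true)) T a
   + (1 - feedback_mean nu b) * expected_pulls nu (shift pi (b, false)) T a)).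
  rewrite [LHS](expect_observedS nu _ _ (fun o => (pulls a o)%:R)).
  apply: eq_bigr => b _; congr (_ * _).
  rewrite /pulls /=.
  have h f : expect nu (shift pi (b, f)) T (fun s => ((b == a) +
       count (fun x => x.1 == a) (observed s))%N%:R) =
       (b == a)%:R + expected_pulls nu (shift pi (b, f)) T a.
    by under expect_eq do rewrite natrD; rewrite expectD expect_cst.
  by rewrite !h; ring.
rewrite expect_observedS mulr_sumr -sumrB; apply: ler_sum => b _.
rewrite mulrCA -mulrBr ler_wpM2l ?pmf_ge0 //.
rewrite /=; set Et := expect nu (shift pi (b, true)) T _.
set Ef := expect nu (shift pi (b, false)) T _.
have IHt : Et - d * expected_pulls nu (shift pi (b, true)) T a <= ln (G b true).
  exact: IH (shift pi (b, true)) (fun o => F ((b, true) :: o)).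
have IHf : Ef - d * expected_pulls nu (shift pi (b, false)) T a <= ln (G b false).
  exact: IH (shift pi (b, false)) (fun o => F ((b, false) :: o)).
have /andP[l0 l1] : 0 <= feedback_mean nu b <= 1.
  by have := feedback_mean01 nu b; rewrite in_itv.
have {}IHt := ler_wpM2l l0 IHt.
have l1' : 0 <= 1 - feedback_mean nu b by lra.
have {}IHf := ler_wpM2l l1' IHf.
(* The first feedback costs nothing if its arm is not [a], the two laws being equal. For arm [a] it
   costs [d], matched by the extra pull counted in [(b == a)%:R]. *)
rewrite /H; have [ba|ba] := eqVneq b a; last first.
  have ac : bernoulli_abs_cont (feedback_mean nu b) (feedback_mean nu b).
    by rewrite /bernoulli_abs_cont !orbN.
  rewrite nub //= add0r.
  have := bernoulli_gibbs (feedback_mean01 nu b) (feedback_mean01 nu b) ac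
     (G0 b true) (G0 b false).
  rewrite bernoulli_klrxx.
  rewrite !mulrBr in IHt IHf; lra.
subst b.
have := bernoulli_gibbs (feedback_mean01 nu a) (feedback_mean01 nu' a) nua
     (G0 a true) (G0 a false).
rewrite -/d (_ : true%:R = 1) //; lra.
Qed.

End Trajectories.

(** * Regret decomposition and lower bound on the number of pulls *)

Section Regret.
Set Implicit Arguments.
Unset Strict Implicit.
Unset Printing Implicit Defensive.
Variables (R : realType) (K : nat) (g : 'I_K -> R -> R).
Implicit Types (nu : bandit g) (pi : algorithm R K) (a b : 'I_K).

(** Given the selected arm, each centred reward has mean zero, as for martingale increments. *)
Lemma expect_reward nu pi T :
  expect nu pi T (fun s => \sum_(x <- s) ((x.2.1 : nat)%:R - mean nu x.1)) = 0.
Proof.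
elim: T pi => [|T IH] pi; first by rewrite expect0 big_nil.
rewrite expectS big1 // => a _.
rewrite (eq_bigr (fun f => \sum_r law nu a (r, f) * ((r : nat)%:R - mean nu a))).
  rewrite exchange_big /= big_bool /= -!mulr_suml !reward_law /bernoulli_pmf /=.
  by rewrite mulr0n; ring.
move=> f _; apply: eq_bigr => r _; congr (_ * _).
under expect_eq do rewrite big_cons.
by rewrite expectD IH addr0 expect_cst.
Qed.

Lemma sum_pulls (o : seq ('I_K * bool)) : (\sum_a pulls a o = size o)%N.
Proof.
rewrite /pulls; under eq_bigr do rewrite -sum1_count big_mkcond.
rewrite exchange_big /= -sum1_size; apply: eq_bigr => x _.
by rewrite -big_mkcond /= (big_pred1 x.1) // => a; rewrite eq_sym.
Qed.

Lemma sum_expected_pulls nu pi T : \sum_a expected_pulls nu pi T a = T%:R.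
Proof.
rewrite -expect_sum -(expect_cst nu pi T T%:R); apply: expect_eq => s sT.
by rewrite -natr_sum sum_pulls size_map sT.
Qed.

Lemma expected_pulls_ge0 nu pi T a : 0 <= expected_pulls nu pi T a.
Proof. by rewrite -(expect_cst nu pi T 0); apply: ler_expect. Qed.

Lemma regret_pulls nu pi T : regret pi nu T =
  \sum_a (best_mean nu - mean nu a) * expected_pulls nu pi T a.
Proof.
set m := best_mean nu.
(* By [expect_reward] the added centred rewards have zero expectation; with them the two integrands
   agree on every trajectory. *)
transitivity (expect nu pi T (fun s => \sum_a (m - mean nu a) * (pulls a (observed s))%:R
   + (-1) * \sum_(x <- s) ((x.2.1 : nat)%:R - mean nu x.1))); last first.
  rewrite expectD expectZ expect_reward mulr0 addr0 expect_sum.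
  by apply: eq_bigr => a _; rewrite expectZ.
transitivity (expect nu pi T (fun s => T%:R * m - \sum_(x <- s) (x.2.1 : nat)%:R)).
  apply: eq_bigr => w _; rewrite /=; congr (_ * (_ - _)).
  by rewrite [RHS]big_tuple.
apply: expect_eq => s <-.
elim: s => [|x s IH] /=.
  by rewrite !big_nil big1 => [|a _]; rewrite ?mulr0 ?mul0r ?addr0 ?subr0.
rewrite !big_cons -natr1.
rewrite /pulls /= in IH *; under [X in _ = X + _]eq_bigr do rewrite natrD mulrDr.
rewrite big_split /= (bigD1 x.1) //= eqxx.
rewrite [X in _ = _ + X + _ + _]big1 => [|a /negbTE]; last first.
  by rewrite eq_sym => ->; rewrite mulr0.
rewrite mulr1n mulr1; lra.
Qed.

Lemma mean_le_best nu a : mean nu a <= best_mean nu.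
Proof. exact: (le_bigmax _ (mean nu) a). Qed.

(** * The instance with one mean replaced *)

Section SetMean.
Variables (nu : bandit g) (a : 'I_K) (m : R).
Hypotheses (m01 : m \in `[0, 1]%R) (hg : corruption_function (g a)).

Let gm01 : g a m \in `[0, 1]%R. Proof. exact: hg.2. Qed.

(** Any coupling with the prescribed marginals would do; the product law is the simplest. *)
Definition indep_pair (x : bool * bool) : R :=
  bernoulli_pmf m x.1 * bernoulli_pmf (g a m) x.2.

Lemma indep_pair_ge0 x : 0 <= indep_pair x.
Proof. by rewrite mulr_ge0 ?bernoulli_pmf_itv_ge0. Qed.

Lemma indep_pair_sum1 : \sum_x indep_pair x = 1.
Proof.
rewrite sum_pair /indep_pair /=.
under eq_bigr do rewrite -mulr_sumr sum_bernoulli_pmf mulr1.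
exact: sum_bernoulli_pmf.
Qed.

Definition set_mean_law b : pmf R (bool * bool)%type :=
  if b == a then Pmf indep_pair_ge0 indep_pair_sum1 else law nu b.

Definition set_mean_mean b := if b == a then m else mean nu b.

Lemma set_mean_mean01 b : set_mean_mean b \in `[0, 1]%R.
Proof. by rewrite /set_mean_mean; case: eqP => // _; exact: mean01. Qed.

Lemma set_mean_reward b r :
  \sum_f set_mean_law b (r, f) = bernoulli_pmf (set_mean_mean b) r.
Proof.
rewrite /set_mean_law /set_mean_mean; case: eqP => _; last exact: reward_law.
by rewrite -mulr_sumr sum_bernoulli_pmf mulr1.
Qed.

Lemma set_mean_feedback b f :
  \sum_r set_mean_law b (r, f) = bernoulli_pmf (g b (set_mean_mean b)) f.
Proof.
rewrite /set_mean_law /set_mean_mean; case: eqP => [->|_]; last exact: feedback_law.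
by rewrite -mulr_suml sum_bernoulli_pmf mul1r.
Qed.

Definition set_mean : bandit g :=
  Bandit set_mean_mean01 set_mean_reward set_mean_feedback.

End SetMean.

(** Each pull of an arm other than [a] costs at least the smallest gap [e]. Using the little-o with
    constant [e] makes the final constant 1. *)
Lemma efficient_pulls pi nu a (alpha : R) : uniformly_efficient g pi ->
  (forall b, b != a -> mean nu b < mean nu a) -> 0 < alpha < 1 ->
  \forall T \near \oo, T%:R - expected_pulls nu pi T a <= T%:R `^ alpha.
Proof.
move=> eff opt al; have bestE : best_mean nu = mean nu a.
  apply/eqP; rewrite eq_le mean_le_best andbT; apply: bigmax_le => [|b _].
    by have := mean01 nu a; rewrite in_itv => /andP[].
  by have [->//|/opt/ltW] := eqVneq b a.
have [e e0 egap] : exists2 e : R, 0 < e &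
    forall b, b != a -> e <= mean nu a - mean nu b.
  (* The default 1 keeps the minimum positive even without other arms. *)
  exists (\big[Num.min/1]_(b | b != a) (mean nu a - mean nu b)).
    by apply: lt_bigmin => // b /opt; rewrite subr_gt0.
  by move=> b ba; apply: bigmin_le_cond.
have /eqoP/(_ e e0) := eff nu alpha al.
apply: filterS => T; rewrite [X in _ <= _ * X]ger0_norm ?powR_ge0 //.
move=> /(le_trans (ler_norm _)) /= rT.
rewrite -(ler_pM2l e0); apply: le_trans rT.
rewrite regret_pulls bestE -(sum_expected_pulls nu pi).
rewrite (bigD1 a) //= addrC addrK [leRHS](bigD1 a) //= subrr mul0r add0r.
rewrite mulr_sumr; apply: ler_sum => b ba.
by rewrite ler_wpM2r ?expected_pulls_ge0 ?egap.
Qed.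

(* Change of measure applied to [L (1 - N_a / T)]: under [nu'] its exponential
   moment is at most 2, by convexity of the exponential. *)
Lemma pulls_transport nu nu' a pi T (L : R) : (0 < T)%N ->
  (forall b, b != a -> feedback_mean nu' b = feedback_mean nu b) ->
  bernoulli_abs_cont (feedback_mean nu a) (feedback_mean nu' a) ->
  (T%:R - expected_pulls nu' pi T a) * expR L <= T%:R ->
  L * (1 - expected_pulls nu pi T a / T%:R) <=
  bernoulli_klr (feedback_mean nu a) (feedback_mean nu' a)
    * expected_pulls nu pi T a + ln 2.
Proof.
move=> T0 nub ac hL; have TR0 : 0 < T%:R :> R by rewrite ltr0n.
pose y (o : seq ('I_K * bool)) : R := 1 - (pulls a o)%:R / T%:R.
have Ey (mu : bandit g) : expect mu pi T (y \o @observed K) =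
    1 - expected_pulls mu pi T a / T%:R.
  transitivity (expect mu pi T (fun s =>
     1 + (- T%:R^-1) * (pulls a (observed s))%:R)).
    by apply: expect_eq => s _; rewrite /= /y; ring.
  by rewrite expectD expectZ expect_cst mulNr mulrC.
have := change_of_measure pi T (fun o => L * y o) nub ac.
rewrite [X in X - _ <= _](expectZ _ _ _ _ (y \o @observed K)) Ey => h.
rewrite -lerBlDl; apply: le_trans h _.
rewrite ler_ln ?posrE //; last first.
  by apply: (@expect_gt0 _ _ _ _ _ _ (fun o => expR (L * y o))) => o; exact: expR_gt0.
apply: (@le_trans _ _ (expect nu' pi T (fun s => 1 + (expR L - 1) * (y \o @observed K) s))).
  apply: ler_expect => s sT; rewrite mulrC [_ * (y \o _) _]mulrC /=.
  rewrite [y _ * L]mulrC; apply: expR_chord; rewrite in_itv /= /y.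
  rewrite lerBlDr lerDl divr_ge0 // andbT subr_ge0 ler_pdivrMr // mul1r ler_nat.
  by rewrite -sT -(size_map (fun x => (x.1, x.2.2)) s) count_size.
rewrite expectD expect_cst expectZ Ey.
have N1 : expected_pulls nu' pi T a <= T%:R.
  rewrite -(sum_expected_pulls nu' pi) (bigD1 a) //= lerDl.
  by apply: sumr_ge0 => b _; exact: expected_pulls_ge0.
have q0 : 0 <= 1 - expected_pulls nu' pi T a / T%:R.
  by rewrite subr_ge0 ler_pdivrMr // mul1r.
(* This is [hL] divided by [T]. With [q] the left factor, the moment is at most
   [1 + q (expR L - 1) <= 2 - q <= 2]. *)
have : (1 - expected_pulls nu' pi T a / T%:R) * expR L <= 1.
  rewrite -(ler_pM2r TR0) mul1r; apply: le_trans hL.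
  by rewrite mulrAC mulrBl mul1r divfK ?gt_eqF.
lra.
Qed.

(** The raised mean makes [a] the unique optimal arm of [nu']. If [N < c ln T], transport would give
    [(1 - alpha) ln T <= c d ln T + O(1)], which fails for large [T]. *)
Lemma pulls_lower_bound pi nu a (m c : R) : uniformly_efficient g pi ->
  corruption_function (g a) ->
  (forall b, mean nu b <= m) -> 0 <= m < 1 -> 0 <= c ->
  bernoulli_abs_cont (feedback_mean nu a) (g a m) ->
  c * bernoulli_klr (feedback_mean nu a) (g a m) < 1 ->
  \forall T \near \oo, c * ln T%:R <= expected_pulls nu pi T a.
Proof.
move=> eff hga mle m01 c0 ac cd.
have [m' [/andP[mm' m'1] {}ac {}cd]] :=
  alternative_mean hga (feedback_mean01 nu a) m01 ac cd.
have m'01 : m' \in `[0, 1]%R.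
  by rewrite in_itv /= m'1 andbT; case/andP: m01 => /le_trans -> //; exact: ltW.
pose nu' := set_mean nu m'01 hga.
have fa : feedback_mean nu' a = g a m'.
  by rewrite /feedback_mean /= /set_mean_mean eqxx.
have fb b : b != a -> feedback_mean nu' b = feedback_mean nu b.
  by rewrite /feedback_mean /= /set_mean_mean => /negbTE ->.
have opt b : b != a -> mean nu' b < mean nu' a.
  by rewrite /= /set_mean_mean eqxx => /negbTE ->; exact: le_lt_trans mm'.
set d := bernoulli_klr _ _ in cd.
have d0 : 0 <= d.
  by apply: bernoulli_klr_ge0 => //; [exact: feedback_mean01|exact: hga.2].
have cd0 : 0 <= c * d by rewrite mulr_ge0.
(* With this choice [1 - alpha] is the midpoint of [c * d] and 1, leaving a margin of
   [alpha ln T]. *)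
pose alpha := (1 - c * d) / 2.
have al : 0 < alpha < 1 by rewrite /alpha; lra.
near=> T.
have T0 : (0 < T)%N by near: T; exact: nbhs_infty_gt.
have TR0 : 0 < T%:R :> R by rewrite ltr0n.
have T1 : 1 <= T%:R :> R by rewrite ler1n.
have lnT0 : 0 <= ln T%:R :> R by exact: ln_ge0.
(* The margin must exceed [ln 2] from the transport and [4 * c] from the term in [N / T]; the 1
   makes this strict. *)
have lnT : (ln 2 + 4 * c + 1) / alpha <= ln (T%:R : R).
  rewrite -ler_expR lnK ?posrE //; near: T; exact: nbhs_infty_ger.
have effT : T%:R - expected_pulls nu' pi T a <= T%:R `^ alpha.
  by near: T; exact: efficient_pulls.
(* The exponent [L = (1 - alpha) ln T] is the one for which [T^alpha * expR L = T]. *)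
have hL : (T%:R - expected_pulls nu' pi T a) * expR ((1 - alpha) * ln T%:R) <= T%:R.
  apply: le_trans (ler_wpM2r (expR_ge0 _) effT) _.
  rewrite /powR gt_eqF // -expRD -mulrDl subrKC mul1r lnK ?posrE //.
rewrite -fa in ac.
have := pulls_transport T0 fb ac hL.
rewrite fa -/d; set N := expected_pulls _ _ _ _ => key.
rewrite leNgt; apply/negP => NlnT.
have h1 : d * N <= c * d * ln T%:R.
  by rewrite (mulrC c) -mulrA ler_wpM2l // ltW.
have h2 : (1 - alpha) * ln T%:R * (N / T%:R) <= 4 * c.
  apply: (@le_trans _ _ (ln T%:R * (N / T%:R))).
    apply: ler_wpM2r; first by rewrite divr_ge0 ?expected_pulls_ge0 // ltW.
    by apply: ler_piMl => //; lra.
  rewrite mulrA ler_pdivrMr //.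
  apply: (@le_trans _ _ (c * ln T%:R ^+ 2)).
    by rewrite expr2 mulrCA ler_wpM2l // ltW.
  by rewrite [4 * c]mulrC -mulrA ler_wpM2l // sqr_ln_le.
have /andP[al0 _] := al.
move: lnT; rewrite ler_pdivrMr // => h3.
have h4 : (1 - alpha) * ln T%:R - c * d * ln T%:R = alpha * ln T%:R.
  by rewrite /alpha; field.
move: key; rewrite mulrBr mulr1; lra.
Unshelve. all: by end_near. Qed.

End Regret.

(** * Lower limits and extended-real quotients *)

Section LimitInferior.
Set Implicit Arguments.
Unset Strict Implicit.
Unset Printing Implicit Defensive.
Variable R : realType.
Implicit Types (x : \bar R) (u : nat -> R).
Local Open Scope ereal_scope.

Lemma le_limn_einf (u : (\bar R)^nat) x :
  (\forall n \near \oo, x <= u n) -> x <= limn_einf u.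
Proof.
move=> xu; rewrite limn_einf_lim; apply: lime_ge; first exact: is_cvg_einfs.
case: xu => n0 _ xu; exists n0 => // n /= n0n.
by apply: le_ereal_inf_tmp => _ [k /= nk <-]; apply: xu; exact: leq_trans nk.
Qed.

(* [x <= liminf u], in a form that adds up. *)
Definition eventual_bound (x : \bar R) (u : nat -> R) :=
  forall c : R, c%:E < x -> \forall n \near \oo, (c <= u n)%R.

Lemma eventual_boundD x y u v : -oo < x -> -oo < y ->
  eventual_bound x u -> eventual_bound y v ->
  eventual_bound (x + y) (fun n => u n + v n)%R.
Proof.
move=> x0 y0 xu yv c cxy.
(* Finite bounds share the slack [x + y - c] equally; an infinite one absorbs whatever the other
   leaves. *)
have [c1 [c1x c2y]] : exists c1 : R, c1%:E < x /\ (c - c1)%:E < y.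
  case: x y x0 y0 cxy {xu yv} => [x||] [y||] //= _ _.
  - rewrite -EFinD !lte_fin => h; exists (x - (x + y - c) / 2)%R.
    by rewrite !lte_fin; split; lra.
  - by move=> _; exists (x - 1)%R; rewrite lte_fin ltry; split => //; lra.
  - by move=> _; exists (c - (y - 1))%R; rewrite lte_fin ltry; split => //; lra.
  - by move=> _; exists 0%R; rewrite !ltry.
by near=> n; rewrite -[c](subrKC c1) lerD //; near: n; [exact: xu|exact: yv].
Unshelve. all: by end_near. Qed.

Lemma eventual_bound_sum (I : Type) (r : seq I) (P : pred I) (x : I -> \bar R)
    (u : I -> nat -> R) : (forall i, P i -> 0 <= x i) ->
  (forall i, P i -> eventual_bound (x i) (u i)) ->
  eventual_bound (\sum_(i <- r | P i) x i) (fun n => \sum_(i <- r | P i) u i n)%R.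
Proof.
move=> x0 xu; elim: r => [|i r IH].
  rewrite big_nil => c; rewrite lte_fin => /ltW c0; near=> n.
  by rewrite big_nil.
rewrite big_cons; under [X in eventual_bound _ X]funext do rewrite big_cons.
case: ifP => // Pi; apply: eventual_boundD IH; last exact: xu.
  exact: lt_le_trans (x0 _ Pi).
by apply: (@lt_le_trans _ _ 0) => //; exact: sume_ge0.
Unshelve. all: by end_near. Qed.

Lemma eventual_bound_limn_einf x u : eventual_bound x u ->
  x <= limn_einf (EFin \o u).
Proof.
move=> xu.
have le_einf c : c%:E < x -> c%:E <= limn_einf (EFin \o u).
  by move=> /xu cu; apply: le_limn_einf; apply: filterS cu => n; rewrite lee_fin.
case: x {xu} le_einf => [r||] le_einf.
- apply/lee_subgt0Pr => e e0; apply: le_einf.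
  by rewrite lte_fin ltrBlDr ltrDl.
- by rewrite leye_eq; apply/eqP/eqyP => A _; apply: le_einf; rewrite ltry.
- exact: leNye.
Qed.

(** Passes from the real condition [c * d < 1] to the extended quotient. Infinite divergence gives
    the bound 0, which [u >= 0] meets; zero divergence gives [+oo], and then every [c] satisfies the
    condition. *)
Lemma eventual_bound_kl (gap l y : R) u : (0 < gap)%R ->
  l \in `[0, 1]%R -> y \in `[0, 1]%R -> (forall n, 0 <= u n)%R ->
  (forall c : R, 0 <= c -> bernoulli_abs_cont l y -> c * bernoulli_klr l y < 1 ->
    \forall n \near \oo, c <= u n)%R ->
  eventual_bound (gap%:E / bernoulli_kl l y) (fun n => gap * u n)%R.
Proof.
move=> gap0 l01 y01 u0 hu.
suff h c : (0 < c)%R -> c%:E < gap%:E / bernoulli_kl l y ->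
    \forall n \near \oo, (c <= gap * u n)%R.
  move=> c cx; have [c0|/h] := leP c 0%R; last exact.
  by apply: nearW => n; apply: le_trans c0 _; rewrite mulr_ge0 // ltW.
move=> c0; have [ac|nac] := boolP (bernoulli_abs_cont l y); last first.
  by rewrite bernoulli_kl_infty // invey mule0 lte_fin ltNge ltW.
have kl0 := bernoulli_klr_ge0 l01 y01 ac.
rewrite bernoulli_klE // inver => hc.
have hcd : (c / gap * bernoulli_klr l y < 1)%R.
  move: hc; case: eqVneq => [->|kN0]; first by rewrite mulr0 ltr01.
  rewrite -EFinM lte_fin ltr_pdivlMr; last by rewrite lt_neqAle eq_sym kN0.
  by move=> hc; rewrite mulrAC ltr_pdivrMr // mul1r.
have cg0 : (0 <= c / gap)%R by rewrite divr_ge0 // ltW.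
apply: filterS (hu _ cg0 ac hcd) => n.
by rewrite ler_pdivrMr // mulrC.
Qed.

End LimitInferior.

Theorem theorem1 (R : realType) (K : nat) (hK : (2 <= K)%N)
  (g : 'I_K -> R -> R) (hg : forall a, corruption_function (g a))
  (pi : algorithm R K) (hpi : uniformly_efficient g pi)
  (nu : bandit g)
  (hopt : forall a, a != first_arm hK -> mean nu a < mean nu (first_arm hK))
  (hlt1 : mean nu (first_arm hK) < 1) :
  (\sum_(a < K | a != first_arm hK)
     ((mean nu (first_arm hK) - mean nu a)%:E /
      bernoulli_kl (feedback_mean nu a) (g a (mean nu (first_arm hK))))
   <= limn_einf (fun T : nat => (regret pi nu T / ln T%:R)%:E))%E.
Proof.
set a1 := first_arm hK; set m := mean nu a1.
have m01 : m \in `[0, 1] by exact: mean01.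
have mle b : mean nu b <= m by have [->|/hopt/ltW] := eqVneq b a1.
have gm01 a : g a m \in `[0, 1] by exact: (hg a).2.
pose u a (T : nat) := expected_pulls nu pi T a / ln T%:R.
(* At [T = 0] the default [ln 0 = 0] applies, so the normalised pulls [u a T] are nonnegative for
   all [T]. *)
have lnT0 (T : nat) : 0 <= ln T%:R :> R.
  by case: T => [|T]; [rewrite ln0 | rewrite ln_ge0 // ler1n].
have -> : (fun T : nat => (regret pi nu T / ln T%:R)%:E) =
   EFin \o (fun T => \sum_(a < K | a != a1) (m - mean nu a) * u a T).
  apply/funext => T; rewrite /= regret_pulls.
  have -> : best_mean nu = m.
    apply/eqP; rewrite eq_le mean_le_best andbT; apply: bigmax_le => [|b _] //.
    by move: m01; rewrite in_itv => /andP[].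
  rewrite (bigD1 a1) //= subrr mul0r add0r mulr_suml.
  by congr (_%:E); apply: eq_bigr => a _; rewrite mulrA.
apply: eventual_bound_limn_einf; apply: eventual_bound_sum => a /hopt ma.
  by rewrite mule_ge0 ?inve_ge0 ?bernoulli_kl_ge0 ?feedback_mean01 // lee_fin subr_ge0 ltW.
apply: eventual_bound_kl; rewrite ?subr_gt0 ?feedback_mean01 //.
  by move=> T; rewrite divr_ge0 ?expected_pulls_ge0.
move=> c c0 ac cd.
(* By [hlt1] there is room in [[0, 1]] for a mean above [m], as the alternative instance
   requires. *)
have m01' : 0 <= m < 1 by move: m01; rewrite in_itv /= hlt1 andbT => /andP[].
(* For [T > 1] the logarithm is positive and the quotient in [u] can be cleared. *)
apply: filterS2 (nbhs_infty_gt 1) (pulls_lower_bound hpi (hg a) mle m01' c0 ac cd) => T T1.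
by rewrite ler_pdivlMr // ln_gt0 // ltr1n.
Qed.
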